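(* Let $n\ge 2$. For $a\in\,]0,\pi]$ put $$\sigma(a)=\inf_{\varphi}\,\sup_{x\in\mathbb{R}^{2n-2}}\mu\big(p(\varphi(B^{2n}(a))\cap D_x)\big),\qquad \hat\sigma(a)=\inf_{\varphi}\,\sup_{x\in\mathbb{R}^{2n-2}}\hat\mu\big(p(\varphi(B^{2n}(a))\cap D_x)\big),$$ where $\varphi$ varies over all symplectic embeddings of $B^{2n}(a)$ into $Z^{2n}(\pi)$. Then: (i) $\sigma(a)=0$ for all $a\in\,]0,\pi]$. (ii) $\hat\sigma(a)=0$ for all $a\in\,]0,\pi[$.
   Context: $\mathbb{R}^{2n}$ has coordinates $(x_1,y_1,\dots,x_n,y_n)$ and carries the standard symplectic form $\omega_0=\sum_{i=1}^n dx_i\wedge dy_i$. A $C^\infty$-smooth embedding $\varphi$ of an open subset of $\mathbb{R}^{2n}$ into $\mathbb{R}^{2n}$ is called symplectic if $\varphi^*\omega_0=\omega_0$. An embedding of an arbitrary subset $S\subset\mathbb{R}^{2n}$ into a subset $S'\subset\mathbb{R}^{2n}$ is called symplectic if it extends to a symplectic embedding of a neighbourhood of $S$ into $\mathbb{R}^{2n}$. $B^{2n}(\pi r^2)$ denotes the closed $2n$-dimensional ball of radius $r$ centred at the origin (so $B^{2n}(a)$ has radius $\sqrt{a/\pi}$), $Z^{2n}(\pi)=B^2(\pi)\times\mathbb{R}^{2n-2}$ is the closed symplectic cylinder, $p\colon Z^{2n}(\pi)\to B^2(\pi)$ is the projection to the first factor, and $D_x=B^2(\pi)\times\{x\}$ for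 $x\in\mathbb{R}^{2n-2}$. $\mu$ is Lebesgue measure on $\mathbb{R}^2$. For $T\subset\mathbb{R}^2$ the simply connected hull $\widehat T$ is the union of the closure $\overline T$ and the bounded components of $\mathbb{R}^2\setminus\overline T$, and $\hat\mu(T)=\mu(\widehat T)$. *)

(* Defs.v *)
From HB Require Import structures.
From mathcomp Require Import all_boot all_order all_algebra.
From mathcomp Require Import all_classical all_reals all_analysis.

Set Implicit Arguments.
Unset Strict Implicit.
Unset Printing Implicit Defensive.

Import Order.TTheory GRing.Theory Num.Theory.
Import numFieldNormedType.Exports.

Local Open Scope classical_set_scope.
Local Open Scope ring_scope.

(* R^{2n} is 'M[R]_(n, 2): row i of z is the i-th symplectic pair, so that
   z i 0 = x_i and z i 1 = y_i.  The norm carried by this type is the sup norm;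
   the Euclidean norm is [enorm].  Whenever the first factor R^2 of R^{2n} is
   singled out, n is written m.+1 and the remaining R^{2n-2} is 'M[R]_(m, 2). *)

Section Smooth.
Context {R : realType} {V W : normedModType R}.

(* C^k on an open set U.  Only the values of f on U matter, and in finite
   dimension quantifying over all directions v amounts to quantifying over the
   partial derivatives. *)
Fixpoint Ck_on (k : nat) (U : set V) (f : V -> W) : Prop :=
  if k is k'.+1 then
    (forall z, U z -> differentiable f z) /\
    (forall v : V, Ck_on k' U ('D_v f))
  else forall z, U z -> {for z, continuous f}.

Definition smooth_on (U : set V) (f : V -> W) : Prop :=
  forall k, Ck_on k U f.

(* Injective immersion with a continuous inverse on its image. *)
Definition smooth_embedding (U : set V) (f : V -> W) : Prop :=
  [/\ smooth_on U f,
      forall z, U z -> injective ('d f z) &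
      exists g : W -> V, {within f @` U, continuous g} /\
                         (forall z, U z -> g (f z) = z)].

End Smooth.

Section Symplectic.
Context {R : realType} {n : nat}.
Local Notation V := 'M[R]_(n, 2).

(* dx_i /\ dy_i evaluated on (u, v) is u_{x_i} v_{y_i} - u_{y_i} v_{x_i}. *)
Definition omega0 (u v : V) : R :=
  \sum_(i < n) (u i 0 * v i 1 - u i 1 * v i 0).

Definition open_symplectic_embedding (U : set V) (f : V -> V) : Prop :=
  [/\ open U, smooth_embedding U f &
      forall z, U z -> forall u v : V,
        omega0 ('d f z u) ('d f z v) = omega0 u v].

(* f is a total function standing for its restriction to S. *)
Definition symplectic_embedding (S S' : set V) (f : V -> V) : Prop :=
  f @` S `<=` S' /\
  exists (U : set V) (F : V -> V),
    [/\ S `<=` U, open_symplectic_embedding U F &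
        forall z, S z -> F z = f z].

Definition enorm (z : V) : R := Num.sqrt (\sum_(i < n) \sum_(j < 2) z i j ^+ 2).

Definition eball (a : R) : set V := [set z | enorm z <= Num.sqrt (a / pi)].

End Symplectic.

Section Cylinder.
Context {R : realType} {m : nat}.
Local Notation V := 'M[R]_(m.+1, 2).

Definition cylinder : set V := [set z | eball pi (row ord0 z)].

Definition disc (x : 'M[R]_(m, 2)) : set V :=
  [set z | eball pi (row ord0 z) /\ row' ord0 z = x].

(* The target plane is R * R rather than 'M[R]_(1, 2), because this is the type
   on which the product measure lives. *)
Definition plane_proj (z : V) : R * R := (z ord0 0, z ord0 1).

End Cylinder.

Section Plane.
Context {R : realType}.

Definition mu2 (T : set (R * R)) : \bar R :=
  (@lebesgue_measure R \x @lebesgue_measure R)%E T.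

Definition hull (T : set (R * R)) : set (R * R) :=
  closure T `|`
  [set q | (~` closure T) q /\
           bounded_set (connected_component (~` closure T) q)].

Definition muhat (T : set (R * R)) : \bar R := mu2 (hull T).

End Plane.

Section Sigma.
Context {R : realType}.

(* The ambient dimension is 2n with n = m.+1, so that sigma in dimension 2n
   is [sigma n.-1]. *)
Definition sup_slice (m : nat) (nu : set (R * R) -> \bar R)
    (a : R) (phi : 'M[R]_(m.+1, 2) -> 'M[R]_(m.+1, 2)) : \bar R :=
  ereal_sup [set nu (plane_proj @` ((phi @` eball a) `&` disc x))
            | x in [set: 'M[R]_(m, 2)]].

Definition inf_sup_slice (m : nat) (nu : set (R * R) -> \bar R) (a : R)
    : \bar R :=
  ereal_inf [set sup_slice nu a phi
            | phi in @symplectic_embedding R m.+1 (eball a) cylinder].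

Definition sigma (m : nat) (a : R) : \bar R := inf_sup_slice m mu2 a.

Definition sigmahat (m : nat) (a : R) : \bar R := inf_sup_slice m muhat a.

End Sigma.

(* Main.v *)
Require Import Defs.
From HB Require Import structures.
From mathcomp Require Import all_boot all_order all_algebra.
From mathcomp Require Import all_classical all_reals all_analysis.
From mathcomp Require Import ring lra.
Import Order.TTheory GRing.Theory Num.Theory.
Import numFieldNormedType.Exports.

(* Let rho = x_1 ^+ 2 + y_1 ^+ 2.  The Hamiltonian N rho y_2 generates a
   symplectic map that rotates the first plane by the angle -2 N y_2, hence
   preserves the cylinder, and replaces x_2 by x_2 + N rho.  Since |x_2| <= 1 on
   the ball, a slice of the image confines rho to an interval of length 2 / N:
   it lies in a thin annulus of the unit disc, which settles (i).
   For (ii), first embed the open unit disc into the disc slit along a radius,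
   preserving area; for a < pi the image of the ball keeps away from the slit
   and from the centre.  As y_2 is constant on a slice, the rotation there is
   rigid, so the closure of the slice misses a radius of the disc, and its hull
   does not fill the hole of the annulus. *)

Set Implicit Arguments.
Unset Strict Implicit.
Unset Printing Implicit Defensive.

Local Open Scope classical_set_scope.
Local Open Scope ring_scope.

(** * Closure properties of C^k functions *)

Section CkGeneral.
Context {R : realType} {V W : normedModType R}.
Implicit Types (U : set V) (f g : V -> W).

Lemma Ck_onW k U f : Ck_on k.+1 U f -> Ck_on k U f.
Proof.
elim: k f => [|k IH] f [df Df].
  by move=> z /df /differentiable_continuous.
by split=> // v; exact: IH.
Qed.

(** The first-order expansion of [f] at [z] is also one for [g]; uniqueness of the differential then
    identifies ['d g z] with ['d f z]. *)
Lemma near_eq_differentiable f g z :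
  {near z, f =1 g} -> differentiable f z -> differentiable g z.
Proof.
move=> fg df.
have gE : g \o shift z = cst (g z) + 'd f z +o_ 0 id.
  apply/eqaddoP => e e0.
  have [_ /eqaddoP/(_ e e0) fE] := (diff_locallyP z f).1 df.
  have := fg; rewrite (near_shift 0 z) subr0.
  apply: filterS2 fE => x /= + fgx.
  by rewrite !fctE /= (nbhs_singleton fg) fgx.
have cf : continuous ('d f z) by exact: diff_continuous.
by apply/diff_locallyP; rewrite (diff_unique cf gE).
Qed.

(** Equality on the open set [U] is equality near each of its points, so it passes to directional
    derivatives. The rules below use this to replace ['D_v] of a compound by a formula established
    only on [U]. *)
Lemma eq_Ck_on k U f g : open U -> (forall z, U z -> f z = g z) ->
  Ck_on k U f -> Ck_on k U g.
Proof.
move=> oU.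
have near_eq f' g' z : (forall z, U z -> f' z = g' z) -> U z ->
    {near z, f' =1 g'}.
  by move=> fg Uz; apply: filterS fg _; exact: open_nbhs_nbhs.
elim: k f g => [|k IH] f g fg.
  move=> cf z Uz; have := cf z Uz; rewrite /prop_for /continuous_at fg//.
  by apply: cvg_trans; apply/near_eq_cvg/near_eq.
move=> [df Df]; split.
  by move=> z Uz; apply: near_eq_differentiable (df _ Uz); exact: near_eq.
move=> v; apply: IH (Df v) => z Uz.
exact/near_eq_derive/near_eq.
Qed.

Lemma Ck_on_cst k U (w : W) : Ck_on k U (cst w).
Proof.
elim: k w => [|k IH] w; first by move=> z _; exact: cvg_cst.
split=> [z _|v]; first exact: differentiable_cst.
rewrite (_ : 'D_v (cst w) = cst 0); first exact: IH.
by apply/funext => x; rewrite derive_cst.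
Qed.

Lemma Ck_on_linear k U f : linear f -> continuous f -> Ck_on k U f.
Proof.
move=> lf cf.
pose fM := GRing.isLinear.Build _ _ _ _ _ lf.
pose fL : {linear _ -> _} := HB.pack f fM.
case: k => [|k]; first by move=> z _; exact: cf.
split=> [z _|v]; first by apply: (@linear_differentiable _ _ _ fL).
rewrite (_ : 'D_v f = cst (f v)); first exact: Ck_on_cst.
apply/funext => x; rewrite deriveE; last first.
  exact: (@linear_differentiable _ _ _ fL).
by rewrite (@diff_lin _ _ _ fL).
Qed.

Lemma Ck_onD k U f g : open U -> Ck_on k U f -> Ck_on k U g ->
  Ck_on k U (fun z => f z + g z).
Proof.
move=> oU; elim: k f g => [|k IH] f g.
  by move=> cf cg z Uz; apply: continuousD; [exact: cf|exact: cg].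
move=> [df Df] [dg Dg]; split=> [z Uz|v].
  by apply: differentiableD; [exact: df|exact: dg].
apply: eq_Ck_on (IH _ _ (Df v) (Dg v)) => // z Uz.
rewrite (_ : (fun _ => _) = f + g)// deriveD//; apply: diff_derivable;
  [exact: df|exact: dg].
Qed.

Lemma Ck_on_sum (I : Type) (r : seq I) k U (f : I -> V -> W) : open U ->
  (forall i, Ck_on k U (f i)) -> Ck_on k U (fun z => \sum_(i <- r) f i z).
Proof.
move=> oU Cf; elim: r => [|i r IH].
  by rewrite (_ : (fun _ => _) = cst 0) ?funeqE => [|z];
    [exact: Ck_on_cst|rewrite big_nil].
rewrite (_ : (fun _ => _) = (fun z => f i z + \sum_(i <- r) f i z)).
  exact: Ck_onD.
by rewrite funeqE => z; rewrite big_cons.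
Qed.

Lemma Ck_onZl k U (f : V -> R) (w : W) : open U -> Ck_on k U f ->
  Ck_on k U (fun z => f z *: w).
Proof.
move=> oU; elim: k f => [|k IH] f.
  by move=> cf z Uz; apply: continuousZr_tmp; exact: cf.
move=> [df Df]; split=> [z Uz|v].
  by apply: differentiableZl; exact: df.
apply: eq_Ck_on (IH _ (Df v)) => // z Uz.
rewrite !deriveE//; last by apply: df.
  by rewrite diffZl//; exact: df.
by apply: differentiableZl; exact: df.
Qed.

End CkGeneral.

Section CkScalar.
Context {R : realType} {V : normedModType R}.
Implicit Types (U : set V) (f g : V -> R).

Lemma Ck_onM k U f g : open U -> Ck_on k U f -> Ck_on k U g ->
  Ck_on k U (fun z => f z * g z).
Proof.
move=> oU; elim: k f g => [|k IH] f g.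
  by move=> cf cg z Uz; apply: continuousM; [exact: cf|exact: cg].
move=> Cf Cg; have [df Df] := Cf; have [dg Dg] := Cg; split=> [z Uz|v].
  by apply: differentiableM; [exact: df|exact: dg].
(* Leibniz rule: the induction hypothesis also takes the factors themselves at the lower order,
   which [Ck_onW] provides. *)
have := Ck_onD oU (IH _ _ (Ck_onW Cf) (Dg v)) (IH _ _ (Ck_onW Cg) (Df v)).
apply: eq_Ck_on => // z Uz.
rewrite (_ : (fun x => _) = f * g)// deriveM//; apply: diff_derivable;
  [exact: df|exact: dg].
Qed.

Lemma Ck_onN k U f : open U -> Ck_on k U f -> Ck_on k U (fun z => - f z).
Proof.
move=> oU Cf; have := Ck_onM oU (Ck_on_cst k U (-1 : R)) Cf.
by apply: eq_Ck_on => // z _; rewrite /= mulN1r.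
Qed.

Lemma Ck_on_comp k U (A : set R) (g : R -> R) f : open U ->
  (forall z, U z -> A (f z)) -> Ck_on k A g -> Ck_on k U f ->
  Ck_on k U (fun z => g (f z)).
Proof.
move=> oU UA; elim: k g => [|k IH] g.
  move=> cg cf z Uz; apply: continuous_comp; first exact: cf.
  exact/cg/UA.
move=> [dg Dg] Cf; have [df Df] := Cf; split=> [z Uz|v].
  by apply: (@differentiable_comp _ _ _ _ f g); [exact: df|exact/dg/UA].
(* Chain rule; ['D_1 g] is the ordinary derivative of [g]. *)
have := Ck_onM oU (Df v) (IH _ (Dg 1) (Ck_onW Cf)).
apply: eq_Ck_on => // z Uz.
have dfz := df _ Uz; have dgz := dg _ (UA _ Uz).
rewrite !deriveE//; last exact: (@differentiable_comp _ _ _ _ f g).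
transitivity ('d g (f z) ('d f z v)).
  by rewrite -['d f z v in RHS]mulr1 [RHS]linearZ.
exact: (congr1 (fun h => h v) (esym (diff_comp dfz dgz))).
Qed.

End CkScalar.

(** * Smoothness of cosine, sine, inverse, square root and arcsine *)

Section CkReal.
Context {R : realType}.
Implicit Types (A : set R) (g : R -> R).

(** On the line the derivative along [v] is [v * g'], so one order of smoothness is gained from a
    known derivative. *)
Lemma Ck_on_is_derive k A g g' : open A ->
  (forall x, A x -> is_derive x 1 g (g' x)) -> Ck_on k A g' -> Ck_on k.+1 A g.
Proof.
move=> oA gg' Cg'.
have dg x : A x -> differentiable g x.
  by move=> /gg' [+ _]; rewrite derivable1_diffP.
split=> // v; have := Ck_onM oA (Ck_on_cst k A v) Cg'.
apply: eq_Ck_on => // x Ax /=; rewrite deriveE; last exact: dg.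
rewrite -[X in 'd g _ X]mulr1 [RHS]linearZ/= -deriveE; last exact: dg.
by have [_ ->] := gg' _ Ax.
Qed.

(** Both are treated at once because each is, up to sign, the derivative of the other. *)
Lemma Ck_on_cos_sin k A : open A -> Ck_on k A cos /\ Ck_on k A sin.
Proof.
move=> oA; elim: k => [|k [IHc IHs]].
  by split=> x _; [exact: continuous_cos|exact: continuous_sin].
split; first by apply: Ck_on_is_derive (Ck_onN oA IHs) => // x _; exact: is_derive_cos.
by apply: Ck_on_is_derive IHc => // x _; exact: is_derive_sin.
Qed.

(** The derivative [- (x^-1 * x^-1)] is built from the function itself, so the induction on the
    order closes. *)
Lemma smooth_inv : smooth_on [set x : R | x != 0] GRing.inv.
Proof.
have oA : open [set x : R | x != 0] by exact: open_neq.
elim=> [|k IH]; first by move=> x x0; exact: inv_continuous.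
apply: Ck_on_is_derive (Ck_onN oA (Ck_onM oA IH IH)) => // x /= x0.
apply: is_derive_eq (is_deriveV x0 (is_derive_id x 1)) _.
by rewrite -exprVn expr2 scaler1.
Qed.

Lemma smooth_sqrt : smooth_on [set x : R | 0 < x] Num.sqrt.
Proof.
have oA : open [set x : R | 0 < x] by exact: open_gt.
elim=> [|k IH]; first by move=> x x0; exact: sqrt_continuous.
have C2 := Ck_onM oA (Ck_on_cst k _ (2 : R)) IH.
have sqrt_neq0 (x : R) : 0 < x -> 2 * Num.sqrt x != 0.
  by move=> x0; rewrite mulf_neq0// gt_eqF// sqrtr_gt0.
have C3 := Ck_on_comp oA sqrt_neq0 (smooth_inv k) C2.
by apply: Ck_on_is_derive C3 => // x /= x0; exact: is_derive1_sqrt.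
Qed.

Lemma smooth_asin : smooth_on [set x : R | -1 < x < 1] asin.
Proof.
have oA : open [set x : R | -1 < x < 1].
  rewrite (_ : mkset _ = [set` `]-1, 1[%R]); first exact: interval_open.
  by apply/seteqP; split => x /=; rewrite in_itv.
case=> [|k]; first by move=> x; exact: continuous_asin.
have Cid j : Ck_on j [set x : R | -1 < x < 1] id.
  by apply: Ck_on_linear => //; move=> x; exact: cvg_id.
have C1 := Ck_onD oA (Ck_on_cst k _ (1 : R)) (Ck_onN oA (Ck_onM oA (Cid k) (Cid k))).
have x21 (x : R) : -1 < x < 1 -> 0 < 1 - x * x by nra.
have C2 := Ck_on_comp oA x21 (smooth_sqrt k) C1.
have sqrt_neq0 (x : R) : -1 < x < 1 -> Num.sqrt (1 - x * x) != 0.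
  by move=> /x21 ?; rewrite gt_eqF// sqrtr_gt0.
have C3 := Ck_on_comp oA sqrt_neq0 (smooth_inv k) C2.
by apply: Ck_on_is_derive C3 => // x /is_derive1_asin.
Qed.

End CkReal.

(** * Areas of slices and of their hulls *)

Section PlaneMeasure.
Context {R : realType}.
Local Notation lambda := (@lebesgue_measure R).

(* No measurability is required: Lebesgue measure is an outer measure on all
   sets, and the integral of a nonnegative function is a supremum. *)
Lemma ge0_le_integral_nonmeasurable d (T : measurableType d) (mu : {measure set T -> \bar R})
    (f g : T -> \bar R) : (forall x, (0 <= f x)%E) -> (forall x, (f x <= g x)%E) ->
  (\int[mu]_x f x <= \int[mu]_x g x)%E.
Proof.
move=> f0 fg; have g0 x : (0 <= g x)%E by exact: le_trans (f0 x) (fg x).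
rewrite !ge0_integralTE//; apply: ereal_sup_le => _ [h /= hf <-].
by exists h => //= x; exact: le_trans (hf x) (fg x).
Qed.

Lemma le_lebesgue_measure (A B : set R) : A `<=` B -> (lambda A <= lambda B)%E.
Proof.
move=> AB; rewrite /lebesgue_measure /lebesgue_stieltjes_measure.
exact: (@le_mu_ext _ (ocitv_type R) R _ A B AB).
Qed.

(** With [u] and [w] the two square roots on the right, [(u + w) ^+ 2 >= u ^+ 2 + w ^+ 2 >= b - x ^+
    2 >= y ^+ 2]. For [a < x ^+ 2] the root [u] takes its default value [0], and both bounds
    persist. *)
Lemma annulus_section (a b x y : R) : a <= x ^+ 2 + y ^+ 2 <= b ->
  Num.sqrt (a - x ^+ 2) <= `|y| <= Num.sqrt (a - x ^+ 2) + Num.sqrt (b - a).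
Proof.
move=> /andP[axy xyb]; apply/andP; split.
  by rewrite -sqrtr_sqr ler_wsqrtr// lerBlDl.
have ab : a <= b by exact: le_trans axy xyb.
rewrite -sqrtr_sqr -[leRHS]ger0_norm ?addr_ge0 ?sqrtr_ge0// -sqrtr_sqr.
rewrite ler_wsqrtr// sqrrD (sqr_sqrtr (_ : 0 <= b - a)) ?subr_ge0//.
have s0 := sqrtr_ge0 (a - x ^+ 2); have t0 := sqrtr_ge0 (b - a).
have st := mulr_ge0 s0 t0.
have : a - x ^+ 2 <= Num.sqrt (a - x ^+ 2) ^+ 2.
  have [p|p] := leP 0 (a - x ^+ 2); first by rewrite sqr_sqrtr.
  exact: le_trans (ltW p) (sqr_ge0 _).
by rewrite mulr2n; lra.
Qed.

(** Each vertical section lies in two intervals of length [w], and only abscissae in [[-1, 1]]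
    contribute: hence the factor 4. *)
Lemma mu2_annulus_le (B : set (R * R)) (a b : R) : b <= 1 ->
  (forall q, B q -> a <= q.1 ^+ 2 + q.2 ^+ 2 <= b) ->
  (mu2 B <= (4 * Num.sqrt (b - a))%:E)%E.
Proof.
move=> b1 Bab; set w := Num.sqrt (b - a).
have w0 : 0 <= w by exact: sqrtr_ge0.
pose g : R -> \bar R := (cst (2 * w)%:E) \_ `[-1, 1].
(* The product measure is by definition the integral of the measures of the sections, which [g]
   dominates pointwise. *)
apply: (@le_trans _ _ (\int[lambda]_x g x)%E).
  apply: ge0_le_integral_nonmeasurable => x /=; first exact: measure_ge0.
  have [x1|x1] := boolP (x \in `[-1, 1]); last first.
    rewrite (_ : xsection B x = set0) ?measure0.
      by rewrite /g patchE; case: ifP => _ //; rewrite lee_fin mulr_ge0.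
    apply/seteqP; split=> // y; rewrite /xsection/= inE => /Bab/= /andP[_ xyb].
    move/negP: x1; apply; rewrite in_itv/=.
    rewrite -ler_norml -sqrtr_sqr -[leRHS]sqrtr1 ler_wsqrtr//.
    by apply: le_trans b1; apply: le_trans xyb; rewrite lerDl sqr_ge0.
  rewrite /g patchE mem_setE x1.
  set u := Num.sqrt (a - x ^+ 2).
  apply: (@le_trans _ _ (lambda (`[- (u + w), - u] `|` `[u, u + w]))).
    apply: le_lebesgue_measure => y; rewrite /xsection/= inE => /Bab/annulus_section.
    rewrite -/u -/w => /andP[uy yuw]; have [y0|y0] := leP 0 y.
      by right; rewrite in_itv/= -(ger0_norm y0) uy.
    by left; rewrite in_itv/= -[y]opprK !lerN2 -(ltr0_norm y0) yuw.
  have : (lambda (`[(- (u + w))%R, (- u)%R] `|` `[u, (u + w)%R]) <=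
      lambda `[(- (u + w))%R, (- u)%R] + lambda `[u, (u + w)%R])%E by exact: measureU2.
  move=> /le_trans; apply.
  rewrite !lebesgue_measure_itv/= !lte_fin.
  have -> : - (u + w) < - u = (0 < w) by rewrite ltrN2 ltrDl.
  have -> : u < u + w = (0 < w) by rewrite ltrDl.
  case: ifP => [_|]; rewrite -?EFinN -?EFinD lee_fin; lra.
have l11 : lambda `[(-1)%R, 1%R] = 2%:E.
  by rewrite lebesgue_measure_itv/= lte_fin ifT ?ltrN1//; congr EFin; lra.
rewrite /g -integral_mkcond integral_cst//.
rewrite [X in (_ * X)%E]l11 -EFinM lee_fin; lra.
Qed.

End PlaneMeasure.

(** * Hulls of subsets of an annulus that avoid a direction *)

Section Hull.
Context {R : realType}.
Implicit Types (T : set (R * R)) (p q e : R * R).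

Lemma connected_scale p (i : interval R) : connected [set t *: p | t in [set` i]].
Proof.
apply: connected_continuous_connected.
  exact/connected_intervalP/interval_is_interval.
exact/continuous_subspaceT/scalel_continuous.
Qed.

Lemma unbounded_ray p (A : set (R * R)) : p != 0 ->
  [set t *: p | t in [set` `[1, +oo[%R]] `<=` A -> ~ bounded_set A.
Proof.
move=> p0 pA [M [_ /(_ (`|M| + 1))]].
have M1 : M < `|M| + 1 by rewrite (le_lt_trans (ler_norm _))// ltrDl.
move=> /(_ M1) bA.
have np : 0 < `|p| by rewrite normr_gt0.
(* With this factor the norm of [t *: p] exceeds the supposed bound by the norm of [p]. *)
pose t := 1 + (`|M| + 1) / `|p|.
have t1 : 1 <= t by rewrite lerDl divr_ge0// addr_ge0.
have /pA/bA /= : [set t *: p | t in [set` `[1, +oo[%R]] (t *: p).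
  by exists t => //=; rewrite in_itv/= t1.
rewrite normrZ ger0_norm; last by apply: le_trans t1.
rewrite /t mulrDl mul1r divfK ?gt_eqF// => h; lra.
Qed.

(* A point off the annulus escapes to infinity without meeting the closure of
   [T]: radially from outside, through the origin and along [e] from inside. *)
Lemma hull_sub_annulus T e (a b c d : R) :
  (forall q, T q -> [/\ a <= q.1 ^+ 2 + q.2 ^+ 2 <= b,
     d <= q.1 ^+ 2 + q.2 ^+ 2 &
     q.1 * e.1 + q.2 * e.2 <= c * Num.sqrt (q.1 ^+ 2 + q.2 ^+ 2)]) ->
  0 < d -> e.1 ^+ 2 + e.2 ^+ 2 = 1 -> c < 1 ->
  forall q, hull T q -> a <= q.1 ^+ 2 + q.2 ^+ 2 <= b.
Proof.
move=> Tabc d0 e1 c1.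
have e0 : e != 0.
  by apply: contra_eqN e1 => /eqP ->; rewrite !expr0n/= addr0 eq_sym oner_neq0.
pose n2 q := q.1 ^+ 2 + q.2 ^+ 2.
have n2_cont : continuous n2.
  have c2 : continuous (fun x : R => x ^+ 2) by exact: exprn_continuous.
  move=> q; apply: cvgD.
    apply: (@continuous_comp _ _ _ fst (fun x : R => x ^+ 2)); last exact: c2.
    exact: cvg_fst.
  apply: (@continuous_comp _ _ _ snd (fun x : R => x ^+ 2)); last exact: c2.
  exact: cvg_snd.
(* The constraints on [T] are closed conditions, so they pass to [closure T]. *)
pose C := [set q | a <= n2 q] `&` [set q | n2 q <= b] `&` [set q | d <= n2 q] `&`
  [set q | 0 <= c * Num.sqrt (n2 q) - (q.1 * e.1 + q.2 * e.2)].
have cC : closed C.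
  apply: closedI; last first.
    apply: (@closed_comp _ _ _ [set x : R | 0 <= x]); last exact: closed_ge.
    move=> q _; apply: cvgB; apply: cvgM || apply: cvgD.
    - exact: cvg_cst.
    - by apply: (continuous_comp (n2_cont q)); exact: sqrt_continuous.
    - by apply: cvgM; [exact: cvg_fst|exact: cvg_cst].
    - by apply: cvgM; [exact: cvg_snd|exact: cvg_cst].
  apply: closedI; first apply: closedI.
  - by apply: (@closed_comp _ _ _ [set x : R | a <= x]) => //; exact: closed_ge.
  - by apply: (@closed_comp _ _ _ [set x : R | x <= b]) => //; exact: closed_le.
  - by apply: (@closed_comp _ _ _ [set x : R | d <= x]) => //; exact: closed_ge.
have clTC : closure T `<=` C.
  rewrite [C](closure_id _).1//; apply: closure_subset => q /Tabc.
  by case=> /andP[? ?] ? ?; do !split => //=; rewrite subr_ge0.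
(* At [t *: e] with [t >= 0] the angular constraint reads [t <= c * t]; as [c < 1] this forces
   [t = 0], against [d <= t ^+ 2]. *)
have ray_out : [set t *: e | t in [set` `[0, +oo[%R]] `<=` ~` closure T.
  move=> p [t /=]; rewrite in_itv/= andbT => t0 <- /clTC [[_ /=]].
  rewrite /n2/= /GRing.scale/= !exprMn -mulrDr e1 mulr1 sqrtr_sqr ger0_norm//.
  move=> dt.
  have -> : t * e.1 * e.1 + t * e.2 * e.2 = t * (e.1 ^+ 2 + e.2 ^+ 2) by ring.
  rewrite e1; nra.
have n2Z t q : n2 (t *: q) = t ^+ 2 * n2 q.
  by rewrite /n2/= !exprMn mulrDr.
have n2_ge0 q : 0 <= n2 q by rewrite addr_ge0// sqr_ge0.
move=> q [/clTC[[[? ?] _] _]|[Tq bq]]; first exact/andP.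
apply/negPn/negP => nq.
(* Beyond the outer circle the radial ray from [q] stays outside. *)
have [/andP[q0 bq2]|qin] := boolP ((q != 0) && (b < n2 q)).
  apply: (unbounded_ray q0 _ bq); apply: connected_component_max.
  - by exists 1; rewrite ?scale1r//= in_itv/= lexx.
  - move=> p [t /=]; rewrite in_itv/= andbT => t1 <- /clTC[[[_ +] _] _].
    rewrite /mkset n2Z; apply/negP; rewrite -ltNge; apply: lt_le_trans bq2 _.
    by rewrite ler_peMl// exprn_ege1.
  - exact: connected_scale.
(* What remains is [q = 0] or [n2 q < a]. The segment from [q] to the origin, followed by the ray
   along [e], is connected and unbounded. *)
apply: (unbounded_ray e0 _ bq).
apply: (@subset_trans _ ([set t *: q | t in [set` `[0, 1]%R]] `|` [set t *: e | t in [set` `[0, +oo[%R]])).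
  move=> p [t /=]; rewrite in_itv/= andbT => t1 <-; right; exists t => //=.
  by rewrite in_itv/= andbT (le_trans _ t1).
apply: connected_component_max.
- by left; exists 1; rewrite ?scale1r//= in_itv/= lexx ler01.
(* On the segment [n2] is at most [n2 q], hence below [a]; for [q = 0] it is the constraint
   [d <= n2] that fails. *)
- move=> p [[t /=]|/ray_out//]; rewrite in_itv/= => /andP[t0 t1] <- /clTC[[[aq bq'] dq] _].
  move: aq bq' dq; rewrite /mkset !n2Z => aq bq' dq.
  have q0 : q != 0.
    by apply: contraTneq dq => ->; rewrite /n2/= expr0n/= addr0 mulr0 -ltNge.
  move: nq qin; rewrite q0/= -leNgt => /negP nq qb.
  apply: nq; apply/andP; split=> //; apply: le_trans aq _.
  by rewrite ler_piMl// exprn_ile1.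
- apply: connectedU; [|exact: connected_scale|exact: connected_scale].
  by exists 0; split; exists 0; rewrite ?scale0r//= in_itv/= lexx// ler01.
Qed.
End Hull.

(** * The twist *)

Section IsDiff.
Context {R : realType} {V : normedModType R}.
Implicit Types (f g df dg : V -> R) (z : V).

Lemma is_diff_add f g df dg z : is_diff z f df -> is_diff z g dg ->
  is_diff z (fun x => f x + g x) (fun u => df u + dg u).
Proof. by move=> hf hg; exact: is_diffD. Qed.

Lemma is_diff_mul f g df dg z : is_diff z f df -> is_diff z g dg ->
  is_diff z (fun x => f x * g x) (fun u => f z * dg u + g z * df u).
Proof. by move=> hf hg; exact: is_diffM. Qed.

Lemma is_diffE f df z u : is_diff z f df -> 'd f z u = df u.
Proof. by move=> h; rewrite diff_val. Qed.

Lemma is_diff_scale (c : R) f df z : is_diff z f df ->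
  is_diff z (fun x => c * f x) (fun u => c * df u).
Proof. by move=> hf; exact: is_diffZ. Qed.

Lemma is_diff_chain f df (g : R -> R) (l : R) z : is_diff z f df ->
  is_derive (f z) 1 g l -> is_diff z (fun x => g (f x)) (fun u => l * df u).
Proof.
move=> hf [/derivable1_diffP dg gl].
have df' : differentiable f z by exact: ex_diff.
apply: DiffDef; first exact: (@differentiable_comp _ _ _ _ f g).
apply/funext => u; rewrite (_ : (fun x => _) = g \o f)// (diff_comp df' dg)/=.
rewrite -['d f z u]mulr1 [LHS]linearZ/= -gl deriveE// mulrC.
by congr (_ * _); rewrite diff_val.
Qed.

End IsDiff.

Section MatrixValued.
Context {R : realType} {V : normedModType R} {m n : nat}.
Implicit Types f : V -> 'M[R]_(m, n).

Lemma Ck_on_mx k (U : set V) f : open U ->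
  (forall i j, Ck_on k U (fun z => f z i j)) -> Ck_on k U f.
Proof.
move=> oU Cf.
have : Ck_on k U (fun z => \sum_i \sum_j f z i j *: (delta_mx i j : 'M[R]_(m, n))).
  by do 2!(apply: Ck_on_sum => // ?); exact: Ck_onZl.
by apply: eq_Ck_on => // z _; rewrite -matrix_sum_delta.
Qed.

(** Chain rule with the coordinate map, whose differential is read off from the entrywise derivative
    of the identity. *)
Lemma diff_mxE f z u i j : differentiable f z ->
  'd f z u i j = 'd (fun x => f x i j) z u.
Proof.
move=> df; rewrite (_ : (fun x => f x i j) = (fun M : 'M[R]_(m, n) => M i j) \o f)//.
have dc := @differentiable_coord R m n (f z) i j.
rewrite (diff_comp df dc) /= -[RHS]deriveE//.
have dd : derivable (id : 'M[R]_(m, n) -> _) (f z) ('d f z u) by exact: derivable_id.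
by have := derive_mx dd; rewrite derive_id => /matrixP/(_ i j); rewrite mxE.
Qed.

End MatrixValued.

Lemma continuous_mx {R : realType} {T : topologicalType} {m n : nat}
    (f : T -> 'M[R]_(m, n)) (x : T) :
  (forall i j, {for x, continuous (fun w => f w i j)}) -> {for x, continuous f}.
Proof.
move=> cf.
rewrite (_ : f = fun w => \sum_i \sum_j f w i j *: (delta_mx i j : 'M[R]_(m, n))).
  do 2!(apply: cvg_big => [|? _]; first exact: add_continuous).
  by apply: continuousZr_tmp; exact: cf.
by apply/funext => w; rewrite -matrix_sum_delta.
Qed.

(** Pairing [u] with the two elementary matrices of row [i] returns [u i 0] and [- u i 1]. *)
Lemma omega0_nondegenerate {R : realType} {n : nat} (u : 'M[R]_(n, 2)) :
  (forall v, omega0 u v = 0) -> u = 0.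
Proof.
move=> u0; apply/matrixP => i j; rewrite mxE.
have H (k : 'I_2) : omega0 u (delta_mx i k) = u i 0 * (k == 1)%:R - u i 1 * (k == 0)%:R.
  rewrite /omega0 (bigD1 i)//= big1 ?addr0 => [|l li].
    by rewrite !mxE eqxx !(eq_sym k).
  by rewrite !mxE (negbTE li) !mulr0 subr0.
have := H 0; have := H 1; rewrite !u0 /= !mulr1 !mulr0 subr0 sub0r => h0 h1.
case: j => -[|[|//]] j.
  by rewrite (_ : Ordinal _ = 0) -?h0//; exact: val_inj.
by rewrite (_ : Ordinal _ = 1) -1?[LHS]opprK -?h1 ?oppr0//; exact: val_inj.
Qed.

(** The difference of two vectors with the same image pairs to zero with every vector. This gives
    the immersion clause of an embedding. *)
Lemma symplectic_diff_inj {R : realType} {n : nat} (L : {linear 'M[R]_(n, 2) -> 'M[R]_(n, 2)}) :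
  (forall u v, omega0 (L u) (L v) = omega0 u v) -> injective L.
Proof.
move=> Lom u v Luv; apply/eqP; rewrite -subr_eq0; apply/eqP.
apply: omega0_nondegenerate => w; rewrite -Lom linearB Luv subrr.
by rewrite /omega0 big1// => i _; rewrite !mxE !mul0r subrr.
Qed.

Section Twist.
Context {R : realType} {m : nat}.
Local Notation V := 'M[R]_(m.+2, 2).
Implicit Types (U : set V) (p q : V -> R) (z u v : V).

(** The identity [dp /\ dq = dx_1 /\ dy_1] is imposed on all of [V], so [dp] and [dq] vanish on
    vectors whose first row is zero. The map [g] is a left inverse in the plane, continuous at the
    image points; the inverse of [twist] is built from it. *)
Definition area_preserving U p q : Prop :=
  [/\ open U, smooth_on U p, smooth_on U q,
      forall z, U z -> forall u v,
        'd p z u * 'd q z v - 'd q z u * 'd p z v =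
        u ord0 0 * v ord0 1 - u ord0 1 * v ord0 0 &
      exists g : R * R -> R * R, forall z, U z ->
        {for (p z, q z), continuous g} /\ g (p z, q z) = (z ord0 0, z ord0 1)].

Local Notation i1 := (lift ord0 ord0 : 'I_m.+2).

Definition twist_angle (N : R) z : R := - (2 * N) * z i1 1.

(* The time-one map of the Hamiltonian [N * (x_1 ^+ 2 + y_1 ^+ 2) * y_2],
   precomposed with [(p, q)] on the first plane. *)
Definition twist (N : R) p q z : V := \matrix_(i, j)
  if i == ord0 then
    if j == 0 then p z * cos (twist_angle N z) - q z * sin (twist_angle N z)
    else p z * sin (twist_angle N z) + q z * cos (twist_angle N z)
  else if (i == i1) && (j == 0) then z i1 0 + N * (p z * p z + q z * q z)
  else z i j.

Lemma twist00 N p q z : twist N p q z ord0 0 =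
  p z * cos (twist_angle N z) - q z * sin (twist_angle N z).
Proof. by rewrite mxE. Qed.

Lemma twist01 N p q z : twist N p q z ord0 1 =
  p z * sin (twist_angle N z) + q z * cos (twist_angle N z).
Proof. by rewrite mxE. Qed.

Lemma twist10 N p q z :
  twist N p q z i1 0 = z i1 0 + N * (p z * p z + q z * q z).
Proof. by rewrite mxE. Qed.

Lemma twist_lift N p q z i j : (i != ord0) || (j != 0) ->
  twist N p q z (lift ord0 i) j = z (lift ord0 i) j.
Proof.
rewrite mxE /= (inj_eq (lift_inj (h := ord0))).
by case: (i == ord0); case: (j == 0).
Qed.

Lemma Ck_on_coord k U i j : Ck_on k U (fun z : V => z i j).
Proof.
apply: Ck_on_linear; last exact: coord_continuous.
by move=> a u v; rewrite !mxE.
Qed.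

Lemma is_diff_coord z i j : is_diff z (fun z : V => z i j) (fun u => u i j).
Proof.
have lf : linear (fun z : V => z i j) by move=> a u v; rewrite !mxE.
pose fM := GRing.isLinear.Build _ _ _ _ _ lf.
pose fL : {linear _ -> _} := HB.pack (fun z : V => z i j) fM.
apply: DiffDef; first exact: differentiable_coord.
by rewrite (@diff_lin _ _ _ fL) => //; exact: coord_continuous.
Qed.

Lemma smooth_twist N U p q : open U -> smooth_on U p -> smooth_on U q ->
  smooth_on U (twist N p q).
Proof.
move=> oU Cp Cq k; apply: Ck_on_mx => // i j.
have [Cc Cs] := Ck_on_cos_sin k (@openT R).
have Ca : Ck_on k U (twist_angle N).
  by apply: Ck_onM => //; [exact: Ck_on_cst|exact: Ck_on_coord].
have Ccos : Ck_on k U (fun z => cos (twist_angle N z)) by exact: Ck_on_comp Cc Ca.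
have Csin : Ck_on k U (fun z => sin (twist_angle N z)) by exact: Ck_on_comp Cs Ca.
rewrite (_ : (fun z => _) = fun z => if i == ord0 then
    if j == 0 then p z * cos (twist_angle N z) + - (q z * sin (twist_angle N z))
    else p z * sin (twist_angle N z) + q z * cos (twist_angle N z)
  else if (i == i1) && (j == 0) then z i1 0 + N * (p z * p z + q z * q z)
  else z i j); last by apply/funext => z; rewrite mxE.
case: (i == ord0); [case: (j == 0)|case: (_ && _)].
- by apply: (Ck_onD oU); [exact: Ck_onM|apply: Ck_onN => //; exact: Ck_onM].
- by apply: (Ck_onD oU); exact: Ck_onM.
- apply: (Ck_onD oU); first exact: Ck_on_coord.
  apply: (Ck_onM oU); first exact: Ck_on_cst.
  by apply: (Ck_onD oU); exact: Ck_onM.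
- exact: Ck_on_coord.
Qed.

(** Let [rho = p ^+ 2 + q ^+ 2]. The rotation by an angle depending on [y_2] adds [- N drho /\ dy_2]
    to the form, the shift of [x_2] adds [N drho /\ dy_2], and the two cancel. *)
Lemma twist_symplectic N U p q : area_preserving U p q ->
  open_symplectic_embedding U (twist N p q).
Proof.
move=> [oU Cp Cq dpq [g gK]].
have sT : smooth_on U (twist N p q) by exact: smooth_twist.
have omegaT z : U z -> forall u v,
    omega0 ('d (twist N p q) z u) ('d (twist N p q) z v) = omega0 u v.
  move=> Uz u v.
  have dT : differentiable (twist N p q) z by have [+ _] := sT 1%N; apply.
  have dp : is_diff z p ('d p z) by apply: DiffDef => //; have [+ _] := Cp 1%N; apply.
  have dq : is_diff z q ('d q z) by apply: DiffDef => //; have [+ _] := Cq 1%N; apply.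
  move: (dpq z Uz u v) dp dq.
  move: ('d p z : V -> R) ('d q z : V -> R) => Lp Lq dpqz dp dq.
  have da : is_diff z (twist_angle N) (fun u => - (2 * N) * u i1 1).
    exact/is_diff_scale/is_diff_coord.
  have dc := is_diff_chain da (is_derive_cos (twist_angle N z)).
  have ds := is_diff_chain da (is_derive_sin (twist_angle N z)).
  have entry i j f df : is_diff z f df -> (forall x, twist N p q x i j = f x) ->
      forall w, 'd (twist N p q) z w i j = df w.
    move=> h fE w; rewrite diff_mxE// (_ : (fun x => _) = f) ?diff_val//.
    by apply/funext.
  have dP := is_diff_add (is_diff_mul dp dc)
    (is_diff_scale (-1) (is_diff_mul dq ds)).
  have dQ := is_diff_add (is_diff_mul dp ds) (is_diff_mul dq dc).
  have dX := is_diff_add (is_diff_coord z i1 0)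
    (is_diff_scale N (is_diff_add (is_diff_mul dp dp) (is_diff_mul dq dq))).
  have twist00' x : twist N p q x ord0 0 = p x * cos (twist_angle N x) +
      -1 * (q x * sin (twist_angle N x)) by rewrite twist00 mulN1r.
  have e00 := entry ord0 0 _ _ dP twist00'.
  have e01 := entry ord0 1 _ _ dQ (twist01 N p q).
  have e10 := entry i1 0 _ _ dX (twist10 N p q).
  have eid i j : (i != ord0) || (j != 0) ->
      forall w, 'd (twist N p q) z w (lift ord0 i) j = w (lift ord0 i) j.
    move=> ij; apply: entry (is_diff_coord z _ _) _ => x; exact: twist_lift.
  rewrite /omega0 !big_ord_recl.
  rewrite !e00 !e01 !e10 !eid//.
  rewrite [X in _ + (_ + X)](eq_bigr (fun i : 'I_m =>
    u (lift ord0 (lift ord0 i)) 0 * v (lift ord0 (lift ord0 i)) 1 -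
    u (lift ord0 (lift ord0 i)) 1 * v (lift ord0 (lift ord0 i)) 0)); last first.
    by move=> i _; rewrite !eid.
  rewrite !addrA; congr (_ + _).
  move: dpqz (cos2Dsin2 (twist_angle N z)).
  move: (cos (twist_angle N z)) (sin (twist_angle N z)) => c s <- cs1.
  move: (Lp u) (Lp v) (Lq u) (Lq v) => pu pv qu qv.
  move: (u i1 1) (v i1 1) (u i1 0) (v i1 0) => uy vy ux vx.
  (* Half the differential of [rho] along [u] and along [v]. *)
  pose rhou := p z * pu + q z * qu; pose rhov := p z * pv + q z * qv.
  transitivity ((c ^+ 2 + s ^+ 2) *
      (pu * qv - qu * pv - 2 * N * (rhou * vy - rhov * uy)) +
      ((ux + 2 * N * rhou) * vy - uy * (vx + 2 * N * rhov))).
    by rewrite /rhou /rhov; ring.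
  by rewrite cs1 /rhou /rhov; ring.
split=> //; split=> //.
  by move=> z Uz; apply: symplectic_diff_inj; exact: omegaT.
(* The inverse: [y_2], hence the angle, survives the twist, so the first plane can be rotated back
   and [g] applied; the shift of [x_2] is known because the rotation preserves [rho]. *)
pose a (w : V) := twist_angle N w.
pose P (w : V) : R := w ord0 0 * cos (a w) + w ord0 1 * sin (a w).
pose Q (w : V) : R := w ord0 1 * cos (a w) - w ord0 0 * sin (a w).
pose G (w : V) : V := \matrix_(i, j)
  if i == ord0 then if j == 0 then (g (P w, Q w)).1 else (g (P w, Q w)).2
  else if (i == i1) && (j == 0) then
    w i1 0 - N * (w ord0 0 * w ord0 0 + w ord0 1 * w ord0 1)
  else w i j.
have aT z : a (twist N p q z) = a z by rewrite /a /twist_angle twist_lift.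
have cs z : cos (a z) ^+ 2 + sin (a z) ^+ 2 = 1 by exact: cos2Dsin2.
have PT z : P (twist N p q z) = p z.
  by rewrite /P aT twist00 twist01 -/(a z) -[RHS]mulr1 -(cs z); ring.
have QT z : Q (twist N p q z) = q z.
  by rewrite /Q aT twist00 twist01 -/(a z) -[RHS]mulr1 -(cs z); ring.
exists G; split; last first.
  move=> z Uz; apply/matrixP => i j; rewrite mxE PT QT (gK z Uz).2/=.
  case: (unliftP ord0 i) => [k ->|->].
    rewrite (inj_eq (lift_inj (h := ord0))) /=.
    case: eqP => [->|/eqP k0]; case: eqP => [->|/eqP j0] /=.
    - rewrite twist10 twist00 twist01 -/(a z).
      rewrite -{1}[p z * p z + _]mulr1 -(cs z); ring.
    - by rewrite twist_lift// j0 orbT.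
    - by rewrite twist_lift// k0.
    - by rewrite twist_lift// k0.
  rewrite eqxx; case: j => -[|[|//]] j /=; congr (z _ _); exact: val_inj.
(* Continuity on the image follows from continuity in [V] at each image point. Order-0 instances of
   [Ck_on] serve as continuity statements. *)
apply: continuous_in_subspaceT => w; rewrite inE => -[z Uz <-{w}].
have oT := @openT V.
have coord i j : Ck_on 0 [set: V] (fun w => w i j) by exact: Ck_on_coord.
have ca : Ck_on 0 [set: V] a by apply: Ck_onM => //; exact: Ck_on_cst.
have [Cc Cs] := Ck_on_cos_sin 0 (@openT R).
have ccos : Ck_on 0 [set: V] (fun w => cos (a w)) by exact: Ck_on_comp Cc ca.
have csin : Ck_on 0 [set: V] (fun w => sin (a w)) by exact: Ck_on_comp Cs ca.
have cP : Ck_on 0 [set: V] P by apply: Ck_onD => //; exact: Ck_onM.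
have cQ : Ck_on 0 [set: V] Q.
  by apply: Ck_onD => //; [exact: Ck_onM|apply: Ck_onN => //; exact: Ck_onM].
have cX : Ck_on 0 [set: V] (fun w =>
    w i1 0 + - (N * (w ord0 0 * w ord0 0 + w ord0 1 * w ord0 1))).
  apply: Ck_onD => //; apply: Ck_onN => //; apply: Ck_onM => //.
    exact: Ck_on_cst.
  by apply: Ck_onD => //; exact: Ck_onM.
have cg : {for twist N p q z, continuous (fun w => g (P w, Q w))}.
  apply: (@continuous_comp _ _ _ (fun w => (P w, Q w)) g).
    exact: (cvg_pair (cP (twist N p q z) I) (cQ (twist N p q z) I)).
  by rewrite /= PT QT; exact: (gK z Uz).1.
apply: continuous_mx => i j.
rewrite /prop_for /continuous_at [X in _ --> X]mxE.
rewrite (_ : (fun w => G w i j) = fun w =>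
  if i == ord0 then if j == 0 then (g (P w, Q w)).1 else (g (P w, Q w)).2
  else if (i == i1) && (j == 0) then
    w i1 0 - N * (w ord0 0 * w ord0 0 + w ord0 1 * w ord0 1)
  else w i j); last by apply/funext => w; rewrite mxE.
case: (i == ord0); [case: (j == 0)|case: (_ && _)].
- apply: (@continuous_comp _ _ _ (fun w => g (P w, Q w)) fst); first exact: cg.
  exact: cvg_fst.
- apply: (@continuous_comp _ _ _ (fun w => g (P w, Q w)) snd); first exact: cg.
  exact: cvg_snd.
- exact: cX.
- exact: coord.
Qed.

End Twist.

(** * An area-preserving map from the disc to the slit disc *)

Section SlitDisc.
Context {R : realType}.
Implicit Types (x y t : R).

(** The quantity [t - sin t * cos t] is the area of a circular segment of half-angle [t] in the unit
    disc; its derivative is [2 * sin t ^+ 2]. *)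
Lemma sub_sincos_incr (t1 t2 : R) : 0 <= t1 -> t1 < t2 -> t2 <= pi ->
  t1 - sin t1 * cos t1 < t2 - sin t2 * cos t2.
Proof.
pose K (t : R) := t - sin t * cos t.
have dK (t : R) : is_derive t 1 K (2 * sin t ^+ 2).
  apply: is_derive_eq
    (is_deriveB (is_derive_id t 1) (is_deriveM (is_derive_sin t) (is_derive_cos t))) _.
  rewrite /GRing.scale/= -[X in X - _](cos2Dsin2 t); ring.
apply: (@gtr0_derive1_incr R K 0 pi).
- by move=> t _; have [] := dK t.
- move=> t; rewrite in_itv/= => t0pi; rewrite derive1E; have [_ ->] := dK t.
  by rewrite mulr_gt0// exprn_gt0// sin_gt0_pi.
- apply: continuous_subspaceT => t; apply/differentiable_continuous.
  by apply/derivable1_diffP; have [] := dK t.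
Qed.

(* The fraction of the area of the unit disc lying to the left of [x]. *)
Definition disc_area x : R := (x * Num.sqrt (1 - x * x) + asin x) / pi + 2^-1.

(** Substitution [x = - cos t] with [t = asin x + pi / 2]. *)
Lemma disc_areaE x : -1 < x < 1 ->
  disc_area x = (asin x + pi / 2 - sin (asin x + pi / 2) * cos (asin x + pi / 2)) / pi.
Proof.
move=> /andP[x0 x1]; have xI : -1 <= x <= 1 by rewrite !ltW.
rewrite cosDpihalf sinDpihalf cos_asin// asinK ?in_itv// /disc_area expr2.
have : pi != 0 :> R by rewrite gt_eqF ?pi_gt0.
move: (Num.sqrt _) (asin x) (pi : R) => r t p p0.
by field.
Qed.

Lemma asin_shift_itv x : -1 < x < 1 -> 0 < asin x + pi / 2 < pi.
Proof.
move=> /andP[x0 x1]; have := @asin_gtNpi2 R x; have := @asin_ltpi2 R x.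
by rewrite x0 x1 !ltW//= => /(_ isT) ? /(_ isT) ?; apply/andP; split; lra.
Qed.

Lemma disc_area_itv x : -1 < x < 1 -> 0 < disc_area x < 1.
Proof.
move=> hx; rewrite disc_areaE//; have /andP[t0 t1] := asin_shift_itv hx.
have := sub_sincos_incr (lexx 0) t0 (ltW t1).
have := sub_sincos_incr (ltW t0) t1 (lexx pi).
rewrite sin0 sinpi !mul0r !subr0 => ? ?.
rewrite divr_gt0 ?pi_gt0//= ltr_pdivrMr ?pi_gt0// mul1r//.
Qed.

(** The chord length at [x] divided by the total area [pi]. *)
Lemma is_derive_disc_area x : -1 < x < 1 ->
  is_derive x 1 disc_area (2 / pi * Num.sqrt (1 - x * x)).
Proof.
move=> hx; have h : 0 < 1 - x * x by move/andP: hx => [? ?]; nra.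
have s0 : Num.sqrt (1 - x * x) != 0 by rewrite gt_eqF// sqrtr_gt0.
have s2 : Num.sqrt (1 - x * x) ^+ 2 = 1 - x * x by rewrite sqr_sqrtr// ltW.
have did := is_derive_id x (1 : R).
have d1 := is_deriveB (is_derive_cst (1 : R) x 1) (is_deriveM did did).
have d2 := @is_derive1_comp R Num.sqrt (fun t => 1 - t * t) x _ _ (is_derive1_sqrt h) d1.
have d3 := is_deriveD (is_deriveM did d2) (is_derive1_asin hx).
have d4 := is_deriveD (is_deriveM d3 (is_derive_cst (pi^-1 : R) x 1))
  (is_derive_cst (2^-1 : R) x 1).
apply: is_derive_eq d4 _; rewrite /GRing.scale/= expr2.
move: s0 s2; move: (Num.sqrt _) (pi^-1 : R) => r p r0 r2.
rewrite mulr0; transitivity (p * (r + (1 - x * x) / r)); first by field.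
by rewrite -r2; field.
Qed.

Lemma disc_area_incr x1 x2 : -1 < x1 -> x1 < x2 -> x2 < 1 ->
  disc_area x1 < disc_area x2.
Proof.
move=> x1N x12 x21; apply: (@gtr0_derive1_lt_oo R disc_area (-1) 1) => //.
- by move=> x; rewrite in_itv/= => /is_derive_disc_area[].
- move=> x; rewrite in_itv/= => hx; have [_] := is_derive_disc_area hx.
  rewrite derive1E => ->; rewrite mulr_gt0 ?divr_gt0 ?pi_gt0// sqrtr_gt0.
  by move/andP: hx => [? ?]; nra.
- move=> x; rewrite inE/= in_itv/= => /is_derive_disc_area[dx _].
  exact/differentiable_continuous/derivable1_diffP.
- by rewrite in_itv/= x1N (lt_trans x12).
- by rewrite in_itv/= x21 (lt_trans x1N).
Qed.

(** Strict monotonicity gives a left inverse, and a left inverse of a continuous real function on an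
    open interval is continuous near its image points. *)
Lemma disc_area_inv : exists G : R -> R, forall x, -1 < x < 1 ->
  G (disc_area x) = x /\ {for disc_area x, continuous G}.
Proof.
have inj : {in [set` `](-1 : R), 1[%R] &, injective disc_area}.
  move=> x1 x2; rewrite !inE/= !in_itv/= => /andP[? ?] /andP[? ?] e12.
  case: (ltgtP x1 x2) => // x12.
    by suff : disc_area x1 < disc_area x2; [rewrite e12 ltxx|exact: disc_area_incr].
  by suff : disc_area x2 < disc_area x1; [rewrite e12 ltxx|exact: disc_area_incr].
exists ('pinv_(fun=> 0) [set` `](-1 : R), 1[%R] disc_area) => x hx.
have hK y : y \in `](-1 : R), 1[ ->
    'pinv_(fun=> 0) [set` `](-1 : R), 1[%R] disc_area (disc_area y) = y.
  by move=> hy; apply: pinvKV => //; rewrite inE.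
split; first by apply: hK; rewrite in_itv.
have nx : x \in `](-1 : R), 1[ by rewrite in_itv.
apply: nbhs_singleton (near_can_continuous _ _).
  by apply: filterS (near_in_itvoo nx) => y; exact: hK.
apply: filterS (near_in_itvoo nx) => y; rewrite in_itv/= => /is_derive_disc_area[dx _].
exact/differentiable_continuous/derivable1_diffP.
Qed.

End SlitDisc.

Section DiscToSlitDisc.
Context {R : realType} {m : nat}.
Local Notation V := 'M[R]_(m.+2, 2).
Implicit Types (z u v : V).

(** As a subset of [V] this is the open cylinder over the disc: only the first row is
    constrained. *)
Definition unit_disc : set V := [set z | z ord0 0 * z ord0 0 + z ord0 1 * z ord0 1 < 1].

(** The disc of this radius has the area of the part of the unit disc to the left of [x_1]. *)
Definition slit_radius z : R := Num.sqrt (disc_area (z ord0 0)).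

(* The vertical chord at x is [|y| < sqrt (1 - x ^+ 2)]; it is stretched to a
   full circle minus the slit. *)
Definition slit_angle z : R := pi * (z ord0 1 * (Num.sqrt (1 - z ord0 0 * z ord0 0))^-1).

Definition slit_fst z : R := slit_radius z * cos (slit_angle z).
Definition slit_snd z : R := slit_radius z * sin (slit_angle z).

Lemma unit_disc_itv z : unit_disc z -> -1 < z ord0 0 < 1.
Proof. by rewrite /unit_disc/= => ?; apply/andP; split; nra. Qed.

Lemma unit_disc_chord z : unit_disc z -> 0 < 1 - z ord0 0 * z ord0 0.
Proof. by rewrite /unit_disc/= => ?; nra. Qed.

Lemma unit_disc_area z : unit_disc z -> 0 < disc_area (z ord0 0).
Proof. by move=> /unit_disc_itv/disc_area_itv/andP[]. Qed.

Lemma open_unit_disc : open unit_disc.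
Proof.
pose n2 z : R := z ord0 0 * z ord0 0 + z ord0 1 * z ord0 1.
have cn2 : Ck_on 0 [set: V] n2.
  by apply: Ck_onD openT _ _; apply: Ck_onM openT _ _; exact: Ck_on_coord.
rewrite (_ : unit_disc = n2 @^-1` [set x | x < 1])//.
apply: open_comp => [z _|]; [exact: cn2|exact: open_lt].
Qed.

Lemma Ck_on_disc_area k : Ck_on k [set x : R | -1 < x < 1] disc_area.
Proof.
have oA : open [set x : R | -1 < x < 1].
  rewrite (_ : mkset _ = [set` `]-1, 1[%R]); first exact: interval_open.
  by apply/seteqP; split => x /=; rewrite in_itv.
have Cid : Ck_on k [set x : R | -1 < x < 1] id.
  by apply: Ck_on_linear => //; move=> x; exact: cvg_id.
have Cc (c : R) : Ck_on k [set x : R | -1 < x < 1] (fun=> c) := Ck_on_cst k _ c.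
have C1 := Ck_onD oA (Cc 1) (Ck_onN oA (Ck_onM oA Cid Cid)).
have x21 (x : R) : -1 < x < 1 -> 0 < 1 - x * x by nra.
have C2 := Ck_on_comp oA x21 (smooth_sqrt k) C1.
have C3 := Ck_onD oA (Ck_onM oA Cid C2) (smooth_asin k).
exact: Ck_onD oA (Ck_onM oA C3 (Cc pi^-1)) (Cc 2^-1).
Qed.

Lemma Ck_on_slit_radius k : Ck_on k unit_disc slit_radius.
Proof.
have oU := open_unit_disc.
have C1 := Ck_on_comp oU unit_disc_itv (Ck_on_disc_area k) (Ck_on_coord k _ ord0 0).
exact: Ck_on_comp oU unit_disc_area (smooth_sqrt k) C1.
Qed.

Lemma Ck_on_slit_angle k : Ck_on k unit_disc slit_angle.
Proof.
have oU := open_unit_disc.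
have C0 j : Ck_on k unit_disc (fun z => z ord0 j) by exact: Ck_on_coord.
have C1 := Ck_onD oU (Ck_on_cst k _ (1 : R)) (Ck_onN oU (Ck_onM oU (C0 0) (C0 0))).
have C2 := Ck_on_comp oU unit_disc_chord (smooth_sqrt k) C1.
have neq0 z : unit_disc z -> Num.sqrt (1 - z ord0 0 * z ord0 0) != 0.
  by move=> /unit_disc_chord h; rewrite gt_eqF// sqrtr_gt0.
have C3 := Ck_on_comp oU neq0 (smooth_inv k) C2.
exact: Ck_onM oU (Ck_on_cst k _ (pi : R)) (Ck_onM oU (C0 1) C3).
Qed.

Lemma is_diff_slit_radius z : unit_disc z -> is_diff z slit_radius
  (fun u => (pi * slit_radius z)^-1 * Num.sqrt (1 - z ord0 0 * z ord0 0) * u ord0 0).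
Proof.
move=> Uz; have d1 := is_diff_chain (is_diff_coord z ord0 0)
  (is_derive_disc_area (unit_disc_itv Uz)).
have d2 := is_diff_chain d1 (is_derive1_sqrt (unit_disc_area Uz)).
apply: is_diff_eq d2 _; apply/funext => u; rewrite -/(slit_radius z).
have : slit_radius z != 0 by rewrite gt_eqF// sqrtr_gt0 unit_disc_area.
have : pi != 0 :> R by rewrite gt_eqF// pi_gt0.
move: (pi : R) (slit_radius z) (Num.sqrt _) (u _ _) => P r s t P0 r0.
by field; rewrite r0 P0.
Qed.

(** The coefficient [A] can stay unspecified: the differential of the radius is a multiple of
    [dx_1], so this term drops out of the wedge product. *)
Lemma is_diff_slit_angle z : unit_disc z -> exists A : R, is_diff z slit_angle
  (fun u => A * u ord0 0 + pi * (Num.sqrt (1 - z ord0 0 * z ord0 0))^-1 * u ord0 1).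
Proof.
move=> Uz; have h := unit_disc_chord Uz.
have s0 : Num.sqrt (1 - z ord0 0 * z ord0 0) != 0 by rewrite gt_eqF// sqrtr_gt0.
have dx := is_diff_coord z ord0 0; have dy := is_diff_coord z ord0 1.
have d1 := is_diff_add (is_diff_cst (1 : R) z) (is_diff_scale (-1) (is_diff_mul dx dx)).
have h' : 0 < cst 1 z + -1 * (z ord0 0 * z ord0 0) by rewrite mulN1r.
have d2 := is_diff_chain d1 (is_derive1_sqrt h').
have s0' : Num.sqrt (cst 1 z + -1 * (z ord0 0 * z ord0 0)) != 0 by rewrite mulN1r.
have d3 := is_diff_chain d2 (@is_deriveV R id _ 1 1 s0' (is_derive_id _ (1 : R))).
have d4 := is_diff_scale pi (is_diff_mul dy d3).
move: d4; set s := Num.sqrt _ => d4.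
exists (pi * (z ord0 1 * (s ^- 2 * ((2 * s)^-1 * (2 * z ord0 0))))).
rewrite (_ : slit_angle = fun x => pi * (x ord0 1 *
    (Num.sqrt (cst 1 x + -1 * (x ord0 0 * x ord0 0)))^-1)); last first.
  by apply/funext => x; rewrite mulN1r.
apply: is_diff_eq d4 _; apply/funext => u.
have -> : Num.sqrt (1 - z ord0 0 * z ord0 0) = s by rewrite /s mulN1r.
have -> : (0 : V -> R) u = 0 by [].
by rewrite /GRing.scale/= mulr1; ring.
Qed.

(** In polar coordinates, with [s] the half-chord, [r dr /\ dtheta = r * (s / (pi * r)) * (pi / s)
    dx_1 /\ dy_1 = dx_1 /\ dy_1]. *)
Lemma slit_area_preserving : area_preserving unit_disc slit_fst slit_snd.
Proof.
have oU := open_unit_disc.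
split=> //.
- move=> k; have [Cc _] := Ck_on_cos_sin k (@openT R).
  apply: (Ck_onM oU (Ck_on_slit_radius k)).
  by apply: Ck_on_comp oU _ Cc (Ck_on_slit_angle k).
- move=> k; have [_ Cs] := Ck_on_cos_sin k (@openT R).
  apply: (Ck_onM oU (Ck_on_slit_radius k)).
  by apply: Ck_on_comp oU _ Cs (Ck_on_slit_angle k).
- move=> z Uz u v; have dr := is_diff_slit_radius Uz.
  have [A da] := is_diff_slit_angle Uz.
  have dp := is_diff_mul dr (is_diff_chain da (is_derive_cos _)).
  have dq := is_diff_mul dr (is_diff_chain da (is_derive_sin _)).
  have dpE w : 'd slit_fst z w = _ := is_diffE w dp.
  have dqE w : 'd slit_snd z w = _ := is_diffE w dq.
  rewrite (dpE u) (dqE v) (dqE u) (dpE v); have := cos2Dsin2 (slit_angle z).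
  have : slit_radius z != 0 by rewrite gt_eqF// sqrtr_gt0 unit_disc_area.
  have : Num.sqrt (1 - z ord0 0 * z ord0 0) != 0.
    by rewrite gt_eqF// sqrtr_gt0 unit_disc_chord.
  have : pi != 0 :> R by rewrite gt_eqF// pi_gt0.
  move: (cos (slit_angle z)) (sin (slit_angle z)) (slit_radius z) (Num.sqrt _) (pi : R).
  move: (u ord0 0) (u ord0 1) (v ord0 0) (v ord0 1) => ux uy vx vy c s r t P P0 t0 r0 cs.
  transitivity ((c ^+ 2 + s ^+ 2) * (ux * vy - uy * vx)); last by rewrite cs mul1r.
  by field; rewrite r0 P0 t0.
have [G GK] := @disc_area_inv R.
pose n2 (w : R * R) := w.1 * w.1 + w.2 * w.2.
(* The polar angle in []-pi, pi[] by the half-angle formula; the denominator vanishes only on the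
   slit, so this branch is continuous off it. *)
pose Y (w : R * R) : R := 2 * atan (w.2 / (Num.sqrt (n2 w) + w.1)) *
  Num.sqrt (1 - G (n2 w) * G (n2 w)) / pi.
exists (fun w => (G (n2 w), Y w)) => z Uz.
have r0 : 0 < slit_radius z by rewrite sqrtr_gt0 unit_disc_area.
set w0 := (slit_fst z, slit_snd z).
have n2E : n2 w0 = disc_area (z ord0 0).
  rewrite -[RHS]sqr_sqrtr ?ltW ?unit_disc_area// -/(slit_radius z).
  rewrite -[RHS]mulr1 -(cos2Dsin2 (slit_angle z)) /n2/= /slit_fst /slit_snd; ring.
have [Gn2 Gc] := GK _ (unit_disc_itv Uz).
have h := unit_disc_chord Uz.
set s := Num.sqrt (1 - z ord0 0 * z ord0 0).
have s0 : 0 < s by rewrite sqrtr_gt0.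
have ss : s * s = 1 - z ord0 0 * z ord0 0 by rewrite -expr2 sqr_sqrtr// ltW.
pose hf := slit_angle z / 2.
have hfE : slit_angle z = hf *+ 2 by rewrite /hf mulr2n -splitr.
have hf_itv : - (pi / 2) < hf < pi / 2.
  have [ya yb] : - s < z ord0 1 /\ z ord0 1 < s.
    by move: Uz; rewrite /unit_disc/= => ?; split; nra.
  have [ta tb] : -1 < z ord0 1 * s^-1 /\ z ord0 1 * s^-1 < 1.
    by split; rewrite ?ltr_pdivlMr ?ltr_pdivrMr ?mulN1r ?mul1r.
  have p0 := pi_gt0 R; rewrite /hf /slit_angle -/s; apply/andP; split; nra.
have ch0 : 0 < cos hf by exact: cos_gt0_pihalf.
(* This is [1 + cos (2 * hf) = 2 * cos hf ^+ 2], scaled by the radius. *)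
have den : Num.sqrt (n2 w0) + w0.1 = slit_radius z * (2 * cos hf ^+ 2).
  by rewrite n2E /= /slit_fst hfE cos_mulr2n /slit_radius; ring.
have atanE : atan (w0.2 / (Num.sqrt (n2 w0) + w0.1)) = hf.
  rewrite den /= /slit_snd hfE sin_mulr2n -[RHS]tanK ?in_itv//; congr atan.
  rewrite /tan; move: ch0 r0; move: (cos hf) (sin hf) (slit_radius z) => c t r c0 r0.
  by field; rewrite !gt_eqF.
split; last first.
  rewrite /Y atanE n2E Gn2 -/s; congr pair.
  rewrite /hf /slit_angle -/s.
  have s1 : s != 0 by rewrite gt_eqF.
  have : pi != 0 :> R by rewrite gt_eqF// pi_gt0.
  by move: (s) s1 (pi : R) => t t0 P P0; field; rewrite P0 t0.
have cn2 : {for w0, continuous n2}.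
  by apply: continuousD; apply: continuousM; (exact: cvg_fst || exact: cvg_snd).
have cG : {for w0, continuous (fun w : R * R => G (n2 w))}.
  by apply: (@continuous_comp _ _ _ n2 G) => //; rewrite n2E.
have csq : {for w0, continuous (fun w : R * R => Num.sqrt (n2 w))}.
  by apply: (@continuous_comp _ _ _ n2 Num.sqrt) => //; exact: sqrt_continuous.
have cden : {for w0, continuous (fun w : R * R => (Num.sqrt (n2 w) + w.1)^-1)}.
  apply: (@continuous_comp _ _ _ (fun w : R * R => Num.sqrt (n2 w) + w.1) GRing.inv).
    by apply: continuousD; [exact: csq|exact: cvg_fst].
  apply: inv_continuous; rewrite den gt_eqF// mulr_gt0// mulr_gt0// exprn_gt0//.
have cat : {for w0, continuous (fun w : R * R => atan (w.2 / (Num.sqrt (n2 w) + w.1)))}.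
  apply: (@continuous_comp _ _ _ (fun w : R * R => w.2 / (Num.sqrt (n2 w) + w.1)) atan).
    by apply: continuousM; [exact: cvg_snd|exact: cden].
  exact: continuous_atan.
have cs1 : {for w0, continuous (fun w : R * R => Num.sqrt (1 - G (n2 w) * G (n2 w)))}.
  apply: (@continuous_comp _ _ _ (fun w : R * R => 1 - G (n2 w) * G (n2 w)) Num.sqrt).
    by apply: continuousB; [exact: cvg_cst|exact: continuousM].
  exact: sqrt_continuous.
have cY : {for w0, continuous Y}.
  apply: continuousM; last exact: cvg_cst.
  by apply: continuousM; [apply: continuousM; [exact: cvg_cst|]|].
exact: (cvg_pair cG cY).
Qed.

(** From [x_1 >= - k] the radius is bounded below, and the angle is at most [pi * k] in absolute
    value, so the image avoids a sector around the negative axis. *)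
Lemma slit_bounds (k : R) z : 0 < k < 1 -> 
  z ord0 0 ^+ 2 + z ord0 1 ^+ 2 <= k ^+ 2 ->
  [/\ slit_fst z ^+ 2 + slit_snd z ^+ 2 <= 1,
      disc_area (- k) <= slit_fst z ^+ 2 + slit_snd z ^+ 2 &
      - slit_fst z <= - cos (pi * k) * Num.sqrt (slit_fst z ^+ 2 + slit_snd z ^+ 2)].
Proof.
move=> /andP[k0 k1] zk.
have k2 : k ^+ 2 < 1 by rewrite expr2; nra.
have Uz : unit_disc z by rewrite /unit_disc/= -!expr2; exact: le_lt_trans zk k2.
have n2E : slit_fst z ^+ 2 + slit_snd z ^+ 2 = disc_area (z ord0 0).
  rewrite -[RHS]sqr_sqrtr ?ltW ?unit_disc_area// -/(slit_radius z).
  rewrite -[RHS]mulr1 -(cos2Dsin2 (slit_angle z)) /slit_fst /slit_snd; ring.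
have /andP[a0 a1] := disc_area_itv (unit_disc_itv Uz).
have x2 : z ord0 0 ^+ 2 <= k ^+ 2 by have := sqr_ge0 (z ord0 1); lra.
have /andP[kx _] : - k <= z ord0 0 <= k.
  by have := ler_wsqrtr x2; rewrite !sqrtr_sqr (gtr0_norm k0) ler_norml.
rewrite n2E; split; first exact: ltW.
  move: kx; rewrite le_eqVlt => /predU1P[->//|kx]; apply/ltW/disc_area_incr => //.
    by rewrite ltrN2.
  by have /andP[] := unit_disc_itv Uz.
rewrite -/(slit_radius z) mulNr lerN2 /slit_fst mulrC.
have h := unit_disc_chord Uz.
rewrite ler_pM2l ?sqrtr_gt0// -[in leRHS]cos_norm.
set s := Num.sqrt (1 - z ord0 0 * z ord0 0).
have s0 : 0 < s by rewrite sqrtr_gt0.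
have ss : s * s = 1 - z ord0 0 * z ord0 0 by rewrite -expr2 sqr_sqrtr// ltW.
have yk : `|slit_angle z| <= pi * k.
  rewrite /slit_angle -/s normrM ger0_norm ?pi_ge0// ler_pM2l ?pi_gt0//.
  rewrite normrM normfV (gtr0_norm s0) ler_pdivrMr//.
  have ks0 : 0 <= k * s by rewrite mulr_ge0// ltW.
  (* Since [k < 1], [y_1 ^+ 2 <= k ^+ 2 - x_1 ^+ 2 <= k ^+ 2 * (1 - x_1 ^+ 2)]. *)
  have y2 : z ord0 1 ^+ 2 <= (k * s) ^+ 2.
    rewrite exprMn [s ^+ 2]expr2 ss -expr2.
    by have := sqr_ge0 (z ord0 0); nra.
  by have := ler_wsqrtr y2; rewrite !sqrtr_sqr (ger0_norm ks0).
have pk : pi * k <= pi by rewrite ler_piMr ?pi_ge0// ltW.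
move: yk; rewrite le_eqVlt => /predU1P[->//|yk]; apply/ltW.
have pk_itv : pi * k \in `[0, pi] by rewrite in_itv/= pk mulr_ge0 ?pi_ge0 ?ltW.
have yk_itv : `|slit_angle z| \in `[0, pi].
  by rewrite in_itv/= normr_ge0 (le_trans (ltW yk)).
by rewrite ltr_cos.
Qed.

End DiscToSlitDisc.

(** * Bounds on sigma *)

Section SliceBounds.
Context {R : realType} {m : nat}.
Local Notation V := 'M[R]_(m.+2, 2).
Implicit Types (p q : V -> R) (nu : set (R * R) -> \bar R).
Local Notation i1 := (lift ord0 ord0 : 'I_m.+2).

Lemma sum_ord2 (f : 'I_2 -> R) : \sum_(j < 2) f j = f 0 + f 1.
Proof.
by rewrite !big_ord_recl big_ord0 addr0; congr (_ + f _); exact: val_inj.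
Qed.

Lemma eball_sum (a : R) (z : V) : 0 < a -> eball a z ->
  \sum_(i < m.+2) \sum_(j < 2) z i j ^+ 2 <= a / pi.
Proof.
move=> a0; rewrite /eball/= /enorm => h.
have S0 : 0 <= \sum_(i < m.+2) \sum_(j < 2) z i j ^+ 2.
  by do 2!(apply: sumr_ge0 => ? _); exact: sqr_ge0.
by rewrite -ler_sqrt// divr_ge0// ltW// pi_gt0.
Qed.

Lemma eball_row0 (a : R) (z : V) : 0 < a -> eball a z ->
  z ord0 0 ^+ 2 + z ord0 1 ^+ 2 <= a / pi.
Proof.
move=> a0 /(eball_sum a0); apply: le_trans.
rewrite (bigD1 ord0)//= sum_ord2.
by rewrite lerDl; do 2!(apply: sumr_ge0 => ? _); exact: sqr_ge0.
Qed.

Lemma eball_x2 (a : R) (z : V) : 0 < a -> eball a z -> z i1 0 ^+ 2 <= a / pi.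
Proof.
move=> a0 /(eball_sum a0); apply: le_trans.
rewrite (bigD1 i1)//= sum_ord2 -addrA lerDl.
by rewrite addr_ge0 ?sqr_ge0//; do 2!(apply: sumr_ge0 => ? _); exact: sqr_ge0.
Qed.

Lemma inf_sup_slice_eq0 nu (a : R) :
  (forall T, (0 <= nu T)%E) ->
  (forall e : R, 0 < e -> exists phi : V -> V, symplectic_embedding (eball a) (@cylinder R m.+1) phi /\
     forall x, (nu (plane_proj @` ((phi @` eball a) `&` disc x)) <= e%:E)%E) ->
  @inf_sup_slice R m.+1 nu a = 0%E.
Proof.
move=> nu0 small; apply/eqP; rewrite eq_le; apply/andP; split.
  apply/lee_addgt0Pr => e e0; rewrite add0e.
  have [phi [sphi le_e]] := small e e0.
  apply: ge_ereal_inf; exists (sup_slice nu a phi); first by exists phi.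
  by apply: ge_ereal_sup => _ [x _ <-].
apply: le_ereal_inf_tmp => _ [phi _ <-].
(* The slice over [0] witnesses that the supremum is nonnegative. *)
apply: le_trans (nu0 (plane_proj @` ((phi @` eball a) `&` disc 0))) _.
by apply: ereal_sup_ubound; exists 0.
Qed.

Lemma twist_norm N p q z :
  (plane_proj (twist N p q z)).1 ^+ 2 + (plane_proj (twist N p q z)).2 ^+ 2 =
  p z ^+ 2 + q z ^+ 2.
Proof.
rewrite /= twist00 twist01 -[RHS]mulr1 -(cos2Dsin2 (twist_angle N z)).
by move: (cos _) (sin _) => c s; ring.
Qed.

(* On the slice over (x_2', y_2', ...) one has N * rho = x_2' - x_2 with
   |x_2| <= 1. *)
Lemma twist_slice N p q (a : R) x w : 0 < N -> 0 < a <= pi ->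
  (forall z, eball a z -> p z ^+ 2 + q z ^+ 2 <= 1) ->
  (plane_proj @` ((twist N p q @` eball a) `&` disc x)) w ->
  (x ord0 0 - 1) / N <= w.1 ^+ 2 + w.2 ^+ 2 <= Num.min 1 ((x ord0 0 + 1) / N).
Proof.
move=> N0 /andP[a0 api] pq1 [_ [[z za <-] [_ xE]]] <-.
have aT : a / pi <= 1 by rewrite ler_pdivrMr ?pi_gt0// mul1r.
have := le_trans (eball_x2 a0 za) aT.
have -> : x ord0 0 = twist N p q z i1 0 by rewrite -xE mxE.
rewrite twist10 twist_norm => x21.
have [x2a x2b] : -1 <= z i1 0 /\ z i1 0 <= 1 by split; nra.
rewrite le_min pq1// ler_pdivrMr// ler_pdivlMr// !expr2.
by apply/andP; split; nra.
Qed.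

Lemma twist_embedding N U p q (a : R) : area_preserving U p q ->
  eball a `<=` U -> (forall z, eball a z -> p z ^+ 2 + q z ^+ 2 <= 1) ->
  symplectic_embedding (eball a) (@cylinder R m.+1) (twist N p q).
Proof.
move=> apq aU pq1; split.
  move=> _ [z za <-]; rewrite /cylinder/= /eball/= /enorm.
  rewrite divff ?gt_eqF ?pi_gt0// ler_wsqrtr//.
  rewrite big_ord_recl big_ord0 addr0 sum_ord2 !mxE.
  have := twist_norm N p q z; rewrite /= !mxE => ->; exact: pq1.
by exists U, (twist N p q); split=> //; exact: twist_symplectic.
Qed.

(** The choice [N = 32 / e ^+ 2] makes the width [2 / N] equal to [(e / 4) ^+ 2]. The variable [b]
    leaves room for an outer bound truncated at [1]. *)
Lemma small_annuli (e : R) : 0 < e -> exists2 N : R, 0 < N &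
  forall (t b : R), b <= (t + 1) / N -> 4 * Num.sqrt (b - (t - 1) / N) <= e.
Proof.
move=> e0; exists (32 / e ^+ 2); first by rewrite divr_gt0// exprn_gt0.
move=> t b bt; rewrite -ler_pdivlMl// -[leRHS]ger0_norm; last by rewrite mulr_ge0 ?invr_ge0 ?ltW.
rewrite -sqrtr_sqr ler_wsqrtr//; apply: le_trans (lerB bt (lexx _)) _.
rewrite -mulrBl le_eqVlt; apply/orP; left; apply/eqP; field.
by rewrite gt_eqF.
Qed.

Lemma area_preserving_id :
  area_preserving [set: V] (fun z => z ord0 0) (fun z => z ord0 1).
Proof.
split; [exact: openT|by move=> k; exact: Ck_on_coord|by move=> k; exact: Ck_on_coord| |].
  move=> z _ u v.
  have dE i j w : 'd (fun x : V => x i j) z w = w i j.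
    exact: is_diffE (is_diff_coord z i j).
  by rewrite (dE _ _ u) (dE _ _ v) (dE _ _ u) (dE _ _ v).
exists id => z _; split=> //; exact: cvg_id.
Qed.

Lemma sigma_eq0 (a : R) : 0 < a <= pi -> sigma m.+1 a = 0%E.
Proof.
move=> /[dup] ha /andP[a0 api]; apply: inf_sup_slice_eq0 => [T|e e0].
  exact: measure_ge0.
have [N N0 small] := small_annuli e0.
have aT : a / pi <= 1 by rewrite ler_pdivrMr ?pi_gt0// mul1r.
have pq1 (z : V) : eball a z -> z ord0 0 ^+ 2 + z ord0 1 ^+ 2 <= 1.
  by move=> /(eball_row0 a0)/le_trans; apply.
exists (twist N (fun z => z ord0 0) (fun z => z ord0 1)); split.
  by apply: twist_embedding area_preserving_id _ _ => // z _.
move=> x; have := twist_slice N0 ha pq1 => /(_ x) sl.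
apply: le_trans (mu2_annulus_le _ sl) _; first by rewrite ge_min lexx.
by rewrite lee_fin; apply: small; rewrite ge_min lexx orbT.
Qed.

Lemma sigmahat_le (a k d : R) U p q : 0 < a <= pi -> 0 < d -> k < 1 ->
  area_preserving U p q -> eball a `<=` U ->
  (forall z, eball a z -> [/\ p z ^+ 2 + q z ^+ 2 <= 1, d <= p z ^+ 2 + q z ^+ 2 &
     - p z <= k * Num.sqrt (p z ^+ 2 + q z ^+ 2)]) ->
  sigmahat m.+1 a = 0%E.
Proof.
move=> ha d0 k1 apq aU pqE; apply: inf_sup_slice_eq0 => [T|e e0].
  exact: measure_ge0.
have [N N0 small] := small_annuli e0.
have pq1 (z : V) : eball a z -> p z ^+ 2 + q z ^+ 2 <= 1 by case/pqE.
exists (twist N p q); split; first exact: twist_embedding apq aU pq1.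
move=> x; have := twist_slice N0 ha pq1 => /(_ x) sl.
(* The common rotation angle of the slice, determined by its [y_2]; it carries the avoided direction
   [(-1, 0)] to [(- cos om, - sin om)]. *)
pose om := - (2 * N) * x ord0 1.
have hs := @hull_sub_annulus R
  (plane_proj @` ((twist N p q @` eball a) `&` disc x)) (- cos om, - sin om)
  ((x ord0 0 - 1) / N) (Num.min 1 ((x ord0 0 + 1) / N)) k d.
apply: le_trans (mu2_annulus_le _ (hs _ d0 _ k1)) _.
- by rewrite ge_min lexx.
- move=> w Tw; split; first exact: sl.
    have [_ [[z za <-] _] <-] := Tw; rewrite twist_norm; by case: (pqE _ za).
  have [_ [[z za <-] [_ xE]] <-] := Tw; rewrite twist_norm.
  have [_ _ pk] := pqE _ za; apply: le_trans pk.
  have <- : twist_angle N z = om.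
    by rewrite /om /twist_angle -xE mxE twist_lift.
  rewrite /= twist00 twist01 le_eqVlt; apply/orP; left; apply/eqP.
  rewrite -[p z in RHS]mulr1 -(cos2Dsin2 (twist_angle N z)).
  by move: (cos _) (sin _) => c s; ring.
- by rewrite /= !sqrrN cos2Dsin2.
- by rewrite lee_fin; apply: small; rewrite ge_min lexx orbT.
Qed.

End SliceBounds.


Local Close Scope classical_set_scope.
Unset Implicit Arguments.

(* The dimension is 2n with n = m.+1, so n >= 2 reads 2 <= m.+1. *)
Theorem theorem1p1 (R : realType) (m : nat) (n_ge2 : (2 <= m.+1)%N) :
  (forall a : R, 0 < a <= pi -> sigma m a = 0%E) /\
  (forall a : R, 0 < a < pi -> sigmahat m a = 0%E).
Proof.
(* The bound on the dimension provides the second symplectic pair used by the twist. *)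
case: m n_ge2 => [//|m _]; split=> [a|a /andP[a0 api]]; first exact: sigma_eq0.
have pi0 := pi_gt0 R.
(* The radius of the ball; [a < pi] makes it less than [1], which leaves a gap on both sides of the
   slit. *)
pose k := Num.sqrt (a / pi).
have ka : k ^+ 2 = a / pi by rewrite sqr_sqrtr// divr_ge0// ltW.
have k0 : 0 < k by rewrite sqrtr_gt0 divr_gt0.
have k2 : k ^+ 2 < 1 by rewrite ka ltr_pdivrMr// mul1r.
have k1 : k < 1 by nra.
have k01 : 0 < k < 1 by rewrite k0.
have kI : -1 < - k < 1 by apply/andP; split; lra.
have /andP[d0 _] := disc_area_itv kI.
have cos_pik : - cos (pi * k) < 1.
  have pk : pi * k < pi by rewrite gtr_pMr.
  have pk_itv : pi * k \in `[0, pi] by rewrite in_itv/= (ltW pk) andbT mulr_ge0 ?pi_ge0// ltW.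
  have pi_itv : (pi : R) \in `[0, pi] by rewrite in_itv/= lexx pi_ge0.
  by rewrite ltrNl -cospi ltr_cos.
apply: (sigmahat_le _ d0 cos_pik slit_area_preserving).
- by rewrite a0 ltW.
- move=> z /(eball_row0 a0) za; rewrite /unit_disc/= -!expr2.
  by apply: le_lt_trans k2; rewrite ka.
- by move=> z /(eball_row0 a0) za; apply: slit_bounds; rewrite ?ka.
Qed.
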